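(* Let $G$ be a noncyclic finite group of order $n$. (i) If $G$ is a $CP$-group, then $$\omega(\mathcal{R}_G)=\max\{\alpha_p: p\in \pi_n\}.$$ (ii) If $G$ is not a $CP$-group, then $$\omega(\mathcal{R}_G)=\max\Big(\{\alpha_p: p\in \pi_n\}\cup\{\sigma_{|M|}+1: M\in\mathcal{M}\setminus \bigcup_{p\in \pi_{n}}\mathcal{M}_p\}\Big).$$
   Context: The power graph $\Gamma_G$ of a finite group $G$ has vertex set $G$, and two distinct elements are adjacent if one is a power of the other. For a graph $\Gamma$, $N_\Gamma[x]$ denotes the closed neighborhood of $x$ ($x$ together with all vertices adjacent to $x$). Define $x\equiv y$ if $N_\Gamma[x]=N_\Gamma[y]$, and let $U(\Gamma)$ be a complete set of distinct representatives of the classes of this equivalence relation. The reduced graph $\mathcal{R}_\Gamma$ has vertex set $U(\Gamma)$, and two vertices are adjacent if they are adjacent in $\Gamma$. Write $\mathcal{R}_G$ for $\mathcal{R}_{\Gamma_G}$. The clique number $\omega$ is the maximum cardinality of a set of pairwise adjacent vertices. A finite group is a $CP$-group if every element has prime power order (the identity counting as having prime power order). $\pi_n$ denotes the set of prime divisors of $n$. For $k=p_1^{r_1}\cdots p_m^{r_m}$ with distinct primes $p_i$, $m\ge1$, $r_i\ge 1$, set $\sigma_k=1$ if $m=1$ and $\sigma_k=\sum_{i=1}^m r_i$ if $m\ge 2$. Let $G$ be a noncyclic finite group. $\mathcal{M}$ denotes the set of all maximal cyclic subgroups of $G$ (cyclic subgroups not properly contained in another cyclic subgroup). For a prime $p$,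 $\mathcal{M}_p$ is the set of all $p$-subgroups in $\mathcal{M}$. The number $\alpha_p$ is defined as follows. If $\mathcal{M}_p=\emptyset$, then $\alpha_p=0$. If $\mathcal{M}_p=\{M_1,\ldots,M_t\}\neq\emptyset$ (with $t=|\mathcal{M}_p|$), then for each $i\in\{1,\dots,t\}$ write the set of distinct subgroups $$\{M_i\cap M_j: j\in\{1,\dots,t\}\}=\{C_{i1},\ldots,C_{is_i}\},$$ indexed so that $C_{i1}\subsetneq C_{i2}\subsetneq\cdots\subsetneq C_{is_i}=M_i$ (possible since $M_i$ is a cyclic $p$-group). Define the integer $\lambda_i$ by $$p^{\lambda_i}=\begin{cases}\max\{|M_i\cap M|: M\in\mathcal{M}\setminus\mathcal{M}_p\}, & \text{if }\mathcal{M}_p\subsetneq\mathcal{M},\\ p^{-1}, & \text{if }\mathcal{M}_p=\mathcal{M},\end{cases}$$ let $s_i'=\min\{u: 1\le u\le s_i,\ p^{\lambda_i}<|C_{iu}|\}$, and set $$\alpha_p=\max\{s_i-s_i'+\lambda_i+2: 1\le i\le t\}.$$ *)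

(* Defs.v *)
From mathcomp Require Import all_boot all_order all_algebra all_fingroup all_solvable.

Set Implicit Arguments.
Unset Strict Implicit.
Unset Printing Implicit Defensive.

Import Order.TTheory GRing.Theory Num.Theory.

Local Open Scope group_scope.

(* A graph is given by a vertex set V and an adjacency relation e on the      *)
(* ambient finite type, of which only the restriction to V matters.           *)

Definition closed_nbhd (T : finType) (V : {set T}) (e : rel T) (x : T) : {set T} :=
  [set y in V | (y == x) || e x y].

Definition closed_twins (T : finType) (V : {set T}) (e : rel T) : rel T :=
  fun x y => closed_nbhd V e x == closed_nbhd V e y.

(* U is a possible vertex set of the reduced graph of (V, e); the adjacency   *)
(* relation of the reduced graph is again e.                                  *)
Definition is_reduced_vertex_set (T : finType) (V : {set T}) (e : rel T)
    (U : {set T}) : bool :=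
  is_transversal U (equivalence_partition (closed_twins V e) V) V.

Definition clique (T : finType) (e : rel T) (A : {set T}) : bool :=
  [forall x in A, forall y in A, (x != y) ==> e x y].

Definition clique_number (T : finType) (V : {set T}) (e : rel T) : nat :=
  \max_(A : {set T} | (A \subset V) && clique e A) #|A|.

Definition power_adj (gT : finGroupType) : rel gT :=
  fun x y => (x != y) && ((x \in <[y]>) || (y \in <[x]>)).

Definition CP_group (gT : finGroupType) (G : {group gT}) : Prop :=
  forall x : gT, x \in G -> exists p k : nat, prime p /\ #[x] = (p ^ k)%N.

(* Junk value 0 at k = 0 and k = 1.                                           *)
Definition sigma (k : nat) : nat :=
  if size (primes k) == 1%N then 1%N else (\sum_(p <- primes k) logn p k)%N.

Definition maxcyc (gT : finGroupType) (G : {group gT}) : {set {group gT}} :=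
  [set M : {group gT} | [max M of H | (H \subset G) && cyclic H]].

Definition maxcyc_p (gT : finGroupType) (G : {group gT}) (p : nat) :
    {set {group gT}} :=
  [set M in maxcyc G | p.-group M].

Section Alpha.

Variables (gT : finGroupType) (G : {group gT}) (p : nat).

(* C_1 < ... < C_s, listed in increasing order; inclusion is total on these   *)
(* subgroups because M is a cyclic p-group. C_u is the item of index u - 1.   *)
Definition meet_chain (M : {group gT}) : seq {group gT} :=
  sort (fun A B : {group gT} => A \subset B)
       (enum [set (M :&: N)%G | N in maxcyc_p G p]).

(* The exponent of p: all the M :&: N are p-groups, so their maximal order is *)
(* a power of p and logn is its exact exponent.                               *)
Definition lambda (M : {group gT}) : int :=
  if maxcyc_p G p == maxcyc G then (-1)%R
  else Posz (logn p (\max_(N in maxcyc G :\: maxcyc_p G p) #|M :&: N|)).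

(* Indices start at 1, whereas find returns a position starting at 0.         *)
Definition first_above (M : {group gT}) : nat :=
  (find (fun C : {group gT} => (p%:R ^ lambda M < #|C|%:R :> rat)%R)
        (meet_chain M)).+1.

(* The maximum is taken in int with base value 0, which is also the value for *)
(* an empty maxcyc_p G p; it does not affect a nonempty maximum, since        *)
(* first_above M <= size (meet_chain M) and -1 <= lambda M.                   *)
Definition alpha : int :=
  (\big[Order.max/0]_(M in maxcyc_p G p)
     ((size (meet_chain M))%:Z - (first_above M)%:Z + lambda M + 2))%R.

End Alpha.

(* Main.v *)
Require Import Defs.
From mathcomp Require Import all_boot all_order all_algebra all_fingroup all_solvable.
From mathcomp Require Import ring.

(** A clique of the reduced graph is a set of elements of G whose cyclic
    subgroups form a strict chain and no two of which are closed twins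
    ([leq_clique_number], [clique_number_witness]). Its largest element generates
    the others, so it lies in one maximal cyclic subgroup M, and the clique number
    is the maximum over M of the length of the longest chain of M without twins.

    So one has to know when two elements x and y of M, with <[x]> strictly
    inside <[y]>, are twins. Since G is not cyclic, the order of y must then be a
    power of a prime p ([twin_prime_elt]), every maximal cyclic subgroup containing
    x must be a p-group ([twin_pgroup]) and must contain y ([twin_maxcyc]).
    Conversely these conditions are sufficient ([pgroup_twin]).

    If the order of M is not a prime power, M therefore contains no two twins
    generating distinct subgroups, and the longest chains of M are obtained by
    removing one prime factor of the order at a time: they have sigma + 1 elements.

    If M is a p-group, its subgroups form one chain. Those of order at most
    p ^ lambda lie in a maximal cyclic subgroup that is not a p-group, so each is
    alone in its class: this gives lambda + 1 classes. A larger one is twin to the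
    smallest M :&: N containing it, where N runs through the maximal cyclic
    p-subgroups, and distinct meets are not twins: this gives s - s' + 1 classes,
    and the total is the term of alpha at M ([leq_layers], [layers_chain],
    [card_layers]). *)

Set Implicit Arguments.
Unset Strict Implicit.
Unset Printing Implicit Defensive.

Import Order.TTheory GRing.Theory Num.Theory.
Import GroupScope.

(** * Prime factors counted with multiplicity *)

Definition Omega (m : nat) : nat := (\sum_(q <- primes m) logn q m)%N.

(** Summing over an initial segment that does not depend on m is what makes
    additivity a termwise statement about logn. *)
Lemma Omega_bounded N m : 0 < m <= N -> Omega m = (\sum_(0 <= q < N.+1) logn q m)%N.
Proof.
case/andP=> m_gt0 lemN; rewrite /Omega [RHS](bigID (mem (primes m))) /=.
rewrite [X in (_ + X)%N]big1 ?addn0 => [|q /negP mq]; last first.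
  by apply/eqP; rewrite -leqn0 leqNgt logn_gt0; apply/negP.
rewrite -[RHS]big_filter; apply: perm_big; apply: uniq_perm; rewrite ?primes_uniq //.
  by rewrite filter_uniq ?iota_uniq.
move=> q; rewrite mem_filter mem_index_iota /=.
case mq: (q \in primes m) => //=.
move: mq; rewrite mem_primes ltnS => /and3P[_ _ dqm].
by rewrite (leq_trans (dvdn_leq m_gt0 dqm)).
Qed.

Lemma OmegaM a b : 0 < a -> 0 < b -> Omega (a * b) = (Omega a + Omega b)%N.
Proof.
move=> a0 b0; rewrite !(@Omega_bounded (a * b)) -?big_split.
- by apply: eq_bigr => q _; rewrite lognM.
- by rewrite b0 leq_pmull.
- by rewrite a0 leq_pmulr.
- by rewrite muln_gt0 a0 b0 /=.
Qed.

Lemma Omega_prime p : prime p -> Omega p = 1%N.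
Proof. by move=> pp; rewrite /Omega primes_prime // big_seq1 logn_prime ?eqxx. Qed.

Lemma leq_Omega a b : 0 < b -> a %| b -> Omega a <= Omega b.
Proof.
move=> b0 /dvdnP[c def_b]; move: b0; rewrite {}def_b muln_gt0 => /andP[c0 a0].
by rewrite OmegaM // leq_addl.
Qed.

Lemma ltn_Omega a b : 0 < b -> a %| b -> a != b -> Omega a < Omega b.
Proof.
move=> b0 /dvdnP[c def_b]; move: b0; rewrite {}def_b muln_gt0 => /andP[c0 a0].
rewrite OmegaM // -[X in X < _]add0n ltn_add2r => ne.
have c1 : 1 < c by rewrite ltn_neqAle c0 andbT; apply: contraNneq ne => <-; rewrite mul1n.
by rewrite -(Omega_prime (pdiv_prime c1)) leq_Omega ?pdiv_dvd.
Qed.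

(** An integer m > 1 with a single prime divisor is a prime power, so here the
    special value of sigma is not taken. *)
Lemma sigma_not_prime_power m : 1 < m -> (forall p, prime p -> ~~ p.-nat m) -> sigma m = Omega m.
Proof.
move=> m1 nat_m; rewrite /sigma; case: eqP => // sz.
case pm: (primes m) sz => [|r []] // _.
have rP q : prime q -> q %| m -> q = r.
  move=> pq dq; have: q \in primes m by rewrite mem_primes pq dq ltnW.
  by rewrite pm inE => /eqP.
have r_pr : prime r by rewrite -(rP _ (pdiv_prime m1)) ?pdiv_dvd ?pdiv_prime.
case/negP: (nat_m r r_pr); apply/pnatP=> [|q pq dq]; first exact: ltnW.
by rewrite (rP q) ?inE.
Qed.

Lemma not_pnat_witness (p m : nat) : 0 < m -> ~~ p.-nat m ->
  exists q : nat, [/\ prime q, q %| m & q != p].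
Proof.
move=> m0; rewrite /pnat m0 => /allPn[q]; rewrite mem_primes => /and3P[qp _ qm] nqp.
by exists q; split; rewrite // inE in nqp *.
Qed.

Lemma pdiv_pnat (p m : nat) : 1 < m -> p.-nat m -> pdiv m = p.
Proof.
move=> m1 pm; have := pnatP _ (ltnW m1) pm _ (pdiv_prime m1) (pdiv_dvd _).
by rewrite inE => /eqP.
Qed.

(** * Chains in cyclic groups *)

Section CyclicSubgroups.

Variable gT : finGroupType.
Implicit Types (x y z : gT) (C H K : {group gT}).

(** A cyclic group has a unique subgroup of each order, so inclusion can be
    read off the orders. *)
Lemma cyclic_subG_dvdn C H K : cyclic C -> H \subset C -> K \subset C ->
  (H \subset K) = (#|H| %| #|K|).
Proof.
move=> cC sHC sKC; apply/idP/idP=> [|dHK]; first exact: cardSg.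
have /cyclicP[a defK] := cyclicS sKC cC.
have dH : #|H| %| #[a] by rewrite orderE -defK.
have : <[a ^+ (#[a] %/ #|H|)]>%G \in [set L : {group gT} | L \subset <[a]> & #|L| == #|H|].
  by rewrite cycle_sub_group // set11.
rewrite inE -defK => /andP[sLK cardL].
have /eqP -> // : H == <[a ^+ (#[a] %/ #|H|)]>%G :> {set gT}.
by rewrite (eq_subG_cyclic cC) ?(subset_trans sLK) // eq_sym.
Qed.

Lemma cyclic_pgroup_total (p : nat) C H K : cyclic C -> p.-group C -> H \subset C -> K \subset C ->
  (H \subset K) || (K \subset H).
Proof.
move=> cC pC sHC sKC; rewrite (cyclic_subG_dvdn cC sHC sKC) (cyclic_subG_dvdn cC sKC sHC).
have [[a ->] [b ->]] : (exists a, #|H| = p ^ a)%N /\ (exists b, #|K| = p ^ b)%N.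
  by split; [exists (logn p #|H|) | exists (logn p #|K|)];
     apply: card_pgroup; apply: pgroupS pC.
by apply/orP; case/orP: (leq_total a b) => le; [left | right]; apply: dvdn_exp2l.
Qed.

Lemma cyclic_pgroup_subG_card (p : nat) C H K :
  cyclic C -> p.-group C -> H \subset C -> K \subset C ->
  (H \subset K) = (#|H| <= #|K|).
Proof.
move=> cC pC sHC sKC; apply/idP/idP=> [|le]; first exact: subset_leq_card.
case/orP: (cyclic_pgroup_total cC pC sHC sKC) => // sKH.
by have /eqP-> : K == H by rewrite -val_eqE eqEcard sKH.
Qed.

(** Every element is the product of its primary constituents. *)
Lemma mem_of_constt H z : (forall r : nat, prime r -> z.`_r \in H) -> z \in H.
Proof.
move=> Hz; rewrite -(prod_constt z); apply: group_prod => r _.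
have [rp|nrp] := boolP (prime r); first exact: Hz.
suff -> : z.`_r = 1 by apply: group1.
apply/constt1P; apply/pnatP=> // q pq _; rewrite !inE.
by apply: contra nrp => /eqP <-.
Qed.

Definition pcomparable (x y : gT) : bool := (x \in <[y]>) || (y \in <[x]>).

(** Adjacency in the power graph allows two generators of the same cyclic
    subgroup; those are always twins, so only strict inclusions survive in the
    reduced graph. *)
Definition strict_chain (A : {set gT}) : bool :=
  clique (fun x y => (<[x]> \proper <[y]>) || (<[y]> \proper <[x]>)) A.

Lemma strict_chainP (A : {set gT}) : reflect
  {in A &, forall x y, x != y -> (<[x]> \proper <[y]>) \/ (<[y]> \proper <[x]>)} (strict_chain A).
Proof.
apply: (iffP forall_inP) => [ch x y Ax Ay nxy | ch x Ax].
  by apply/orP; move/forall_inP/(_ y Ay)/implyP: (ch x Ax); apply.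
by apply/forall_inP=> y Ay; apply/implyP=> /(ch _ _ Ax Ay)/orP.
Qed.

(** Dropping one prime factor of the order at a time, by passing from x to
    x ^+ p, loses nothing: the chain reaches the upper bound of
    [strict_chain_Omega]. *)
Lemma cyclic_strict_chain C : cyclic C ->
  exists2 A : {set gT}, A \subset C & strict_chain A /\ #|A| = (Omega #|C|).+1.
Proof.
have [m] := ubnP #|C|; elim: m C => // m IHm C /ltnSE-leCm /cyclicP[x defC].
have [C1|C1] := leqP #|C| 1.
  exists [set 1]; rewrite ?sub1G //; split.
    by apply/strict_chainP=> y z /set1P-> /set1P->; rewrite eqxx.
  by rewrite cards1 (_ : #|C| = 1%N) ?/Omega ?big_nil //; apply/eqP; rewrite eqn_leq C1 cardG_gt0.
have pp := pdiv_prime C1; set p := pdiv _ in pp.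
have dp : p %| #[x] by rewrite orderE -defC pdiv_dvd.
have oxp : #|<[x ^+ p]>%G| = (#|C| %/ p)%N.
  by rewrite defC; apply: orderXdiv.
have cC : #|C| = (#|<[x ^+ p]>%G| * p)%N by rewrite oxp divnK // defC.
have ltxp : #|<[x ^+ p]>%G| < #|C| by rewrite oxp ltn_Pdiv ?prime_gt1.
have [A sAx [chA cardA]] := IHm <[x ^+ p]>%G (leq_trans ltxp leCm) (cycle_cyclic _).
have xnA : x \notin <[x ^+ p]>.
  apply: contraL ltxp => xin; rewrite -leqNgt; apply: subset_leq_card.
  by rewrite defC cycle_subG.
have prA y : y \in A -> <[y]> \proper <[x]>.
  move=> /(subsetP sAx) yx; rewrite /= in yx; rewrite properE !cycle_subG.
  rewrite (subsetP _ _ yx) ?cycleX //=; apply: contra xnA => xy.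
  by apply: subsetP xy; rewrite cycle_subG.
exists (x |: A).
  by rewrite subUset sub1set defC cycle_id (subset_trans sAx) ?cycleX.
split; last first.
  rewrite cardsU1 (contra (subsetP sAx x) xnA) cardA cC OmegaM ?(prime_gt0 pp) //.
  by rewrite (Omega_prime pp) addn1.
apply/strict_chainP=> y z /setU1P[->|Ay] /setU1P[->|Az]; rewrite ?eqxx //.
- by right; apply: prA.
- by left; apply: prA.
- exact: (strict_chainP _ chA).
Qed.

(** Along strict inclusions of cyclic groups the orders divide each other
    properly, so Omega separates the elements of the chain. *)
Lemma strict_chain_Omega C (A : {set gT}) :
  A \subset C -> strict_chain A -> #|A| <= (Omega #|C|).+1.
Proof.
move=> sAC /strict_chainP chA.
pose f x : 'I_(Omega #|C|).+1 := inord (Omega #[x]).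
have f_inj : {in A &, injective f}.
  move=> x y Ax Ay; apply: contra_eq => nxy; rewrite -val_eqE /=.
  have le z : z \in A -> Omega #[z] < (Omega #|C|).+1.
    by move=> /(subsetP sAC) Cz; rewrite ltnS leq_Omega ?order_dvdG.
  rewrite !inordK ?le // neq_ltn.
  have lt a b : <[a]> \proper <[b]> -> Omega #[a] < Omega #[b].
    move=> pab; rewrite ltn_Omega ?order_gt0 ?cardSg ?proper_sub //.
    by rewrite neq_ltn !orderE proper_card.
  by apply/orP; case: (chA x y Ax Ay nxy) => /lt; [left | right].
by rewrite -(card_in_imset f_inj) -[X in _ <= X](card_ord) max_card.
Qed.

End CyclicSubgroups.

(** * Closed twins in the power graph *)

Section Twins.
Variables (gT : finGroupType) (G : {group gT}).
Implicit Types (x y z : gT) (A U : {set gT}) (M N H : {group gT}).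

Local Notation twin := (closed_twins G (@power_adj gT)).

(** The closed neighbourhood of an element consists of the elements comparable
    with it, which removes the case distinction in the adjacency relation. *)
Lemma twinP x y :
  reflect {in G, forall z, pcomparable x z = pcomparable y z} (twin x y).
Proof.
have nbE w z : (z \in closed_nbhd G (@power_adj gT) w) = (z \in G) && pcomparable w z.
  rewrite inE /power_adj /= (eq_sym w); case: (eqVneq z w) => //= ->.
  by rewrite /pcomparable cycle_id.
apply: (iffP eqP) => [eqN z Gz | eqN]; last first.
  by apply/setP=> z; rewrite !nbE; case Gz: (z \in G) => //=; apply: eqN.
by move/setP/(_ z): eqN; rewrite !nbE Gz.
Qed.

Lemma pcomparable_sym x y : pcomparable x y = pcomparable y x.
Proof. exact: orbC. Qed.

Lemma cycle_eq_twin x y : <[x]> = <[y]> -> twin x y.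
Proof. by move=> eqc; apply/twinP=> z _; rewrite /pcomparable eqc -!(cycle_subG _ <[z]>) eqc. Qed.

Lemma twin_sym x y : twin x y = twin y x.
Proof. exact: eq_sym. Qed.

Lemma twin_trans y x z : twin x y -> twin y z -> twin x z.
Proof. by move=> /eqP h /eqP h'; rewrite /closed_twins h h'. Qed.

(** Sets meeting each class of closed twins at most once: these are the sets
    that inject into any choice of representatives. *)
Definition separated A := {in A &, forall x y, twin x y -> x = y}.

(** * Cliques of the reduced graph as chains of the group *)

Section ReducedGraph.
Variable U : {set gT}.
Hypothesis hU : is_reduced_vertex_set G (@power_adj gT) U.

Lemma reduced_sub : U \subset G. Proof. by case/and3P: hU. Qed.

Lemma reduced_class x : x \in G -> #|U :&: [set y in G | twin x y]| = 1%N.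
Proof.
move=> Gx; case/and3P: hU => _ _ /forall_inP U1.
by apply/eqP/U1/imsetP; exists x.
Qed.

Lemma reduced_repr x : x \in G -> exists2 u, u \in U & twin x u.
Proof.
move/reduced_class/eqP/cards1P=> [u /setP/(_ u)]; rewrite !inE eqxx.
by case/and3P=> Uu _ xu; exists u.
Qed.

Lemma reduced_separated : separated U.
Proof.
move=> x y Ux Uy xy; have sUG := subsetP reduced_sub.
have /eqP/cards1P[u /setP eqU] := reduced_class (sUG x Ux).
have /set1P -> : x \in [set u] by rewrite -eqU !inE Ux sUG //= /closed_twins.
by apply/esym/set1P; rewrite -eqU !inE Uy sUG.
Qed.

(** Moving each element to the representative of its class keeps the elements
    distinct, and keeps them comparable because twins are comparable with the
    same elements. *)
Lemma leq_clique_number A :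
  A \subset G -> strict_chain A -> separated A -> #|A| <= clique_number U (@power_adj gT).
Proof.
move=> sAG /strict_chainP chA sepA.
pose r x := odflt x [pick u in U | twin x u].
have rP x : x \in A -> r x \in U /\ twin x (r x).
  move/(subsetP sAG)/reduced_repr=> [u Uu xu]; rewrite /r.
  by case: pickP => [v /andP[] | /(_ u)] //; rewrite /= Uu xu.
have r_inj : {in A &, injective r}.
  move=> x y Ax Ay eqr; apply: sepA => //.
  have [[_ xr] [_ yr]] := (rP x Ax, rP y Ay).
  by apply: (twin_trans xr); rewrite eqr twin_sym.
rewrite -(card_in_imset r_inj); apply: (@leq_bigmax_cond _ _ (fun B : {set gT} => #|B|)).
apply/andP; split; first by apply/subsetP=> _ /imsetP[x Ax ->]; case: (rP x Ax).
apply/forall_inP=> _ /imsetP[x Ax ->]; apply/forall_inP=> _ /imsetP[y Ay ->].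
apply/implyP=> nr; rewrite /power_adj nr.
have [[Ux /twinP xr] [Uy /twinP yr]] := (rP x Ax, rP y Ay).
rewrite -/(pcomparable _ _) -xr ?(subsetP reduced_sub) // pcomparable_sym.
rewrite -yr ?(subsetP sAG) // /pcomparable.
have nxy : x != y by apply: contraNneq nr => ->.
by case: (chA x y Ax Ay nxy) => /proper_sub; rewrite cycle_subG => ->; rewrite ?orbT.
Qed.

(** Together with [leq_clique_number], this frees the clique number from
    the chosen representatives: it is the largest size of a separated strict
    chain of G. *)
Lemma clique_number_witness : exists A,
  [/\ A \subset G, strict_chain A, separated A & #|A| = clique_number U (@power_adj gT)].
Proof.
have [|A /andP[sAU clA] eqA] := @eq_bigmax_cond _
    [pred B : {set gT} | (B \subset U) && clique (@power_adj gT) B] (fun B => #|B|).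
  apply/card_gt0P; exists set0; rewrite inE sub0set /=.
  by apply/forall_inP=> x; rewrite inE.
have sepA : separated A.
  by move=> x y /(subsetP sAU) Ux /(subsetP sAU) Uy; apply: reduced_separated.
exists A; split=> //; first exact: subset_trans reduced_sub.
apply/strict_chainP=> x y Ax Ay nxy.
have /andP[_] := implyP (forall_inP (forall_inP clA x Ax) y Ay) nxy.
have ncyc : <[x]> != <[y]> by apply: contraNneq nxy => /cycle_eq_twin/sepA->.
by case/orP; rewrite -cycle_subG => sub; [left | right]; rewrite properEneq sub andbT // eq_sym.
Qed.

End ReducedGraph.

(** * Twins and maximal cyclic subgroups *)

Lemma maxcycP M : reflect
  [/\ M \subset G, cyclic M & forall H, H \subset G -> cyclic H -> M \subset H -> H :=: M]
  (M \in maxcyc G).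
Proof.
rewrite inE; apply: (iffP maxgroupP) => [[/andP[sMG cM] maxM] | [sMG cM maxM]].
  by split=> // H sHG cH; apply: maxM; rewrite sHG.
by split=> [|H /andP[sHG cH]]; [rewrite sMG | apply: maxM].
Qed.

Lemma mem_maxcyc x : x \in G -> exists2 M, M \in maxcyc G & x \in M.
Proof.
move=> Gx; have [|M maxM sxM] := @maxgroup_exists _ (fun H => (H \subset G) && cyclic H) <[x]>%G.
  by rewrite /= cycle_subG Gx cycle_cyclic.
by exists M; rewrite ?inE -?cycle_subG.
Qed.

Lemma mem_maxcyc_gen M : M \in maxcyc G -> exists2 x, x \in G & M :=: <[x]>.
Proof.
by case/maxcycP=> sMG /cyclicP[x defM] _; exists x; rewrite // -cycle_subG -defM.
Qed.

(** An element of largest order in a chain generates all the others, hence any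
    maximal cyclic subgroup containing it contains the chain. *)
Lemma strict_chain_maxcyc A :
  A \subset G -> strict_chain A -> exists2 M, M \in maxcyc G & A \subset M.
Proof.
move=> sAG /strict_chainP chA; have [->|[x0 Ax0]] := set_0Vmem A.
  by have [M MG _] := mem_maxcyc (group1 G); exists M; rewrite ?sub0set.
case: (@arg_maxnP _ x0 (mem A) (fun x => #[x])) => //= x Ax maxx.
have [M MG xM] := mem_maxcyc (subsetP sAG x Ax); exists M => //.
apply/subsetP=> y Ay; have [->//|nyx] := eqVneq y x.
case: (chA y x Ay Ax nyx) => [/proper_sub|/proper_card].
  by rewrite cycle_subG => yx; rewrite (subsetP _ _ yx) ?cycle_subG.
by rewrite ltnNge -!orderE maxx.
Qed.

(** A generator of N is comparable with x, hence with its twin y; since N is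
    maximal, y cannot lie strictly above it. *)
Lemma twin_maxcyc x y N : x \in G -> y \in G -> twin x y -> N \in maxcyc G -> x \in N -> y \in N.
Proof.
move=> Gx Gy /twinP xy NG; have [z Gz defN] := mem_maxcyc_gen NG.
rewrite {1}defN => xz; have := xy z Gz; rewrite /pcomparable xz => /esym/orP[yz|zy].
  by rewrite defN.
have sNy : N \subset <[y]> by rewrite defN cycle_subG.
case/maxcycP: NG => _ _ maxN; by rewrite -(maxN <[y]>%G) ?cycle_subG ?cycle_cyclic ?cycle_id.
Qed.

Lemma dvdn_constt (p : nat) y : prime p -> p %| #[y] -> p %| #[y.`_p].
Proof.
by move=> pp py; rewrite order_constt p_part dvdn_exp // logn_gt0 mem_primes pp order_gt0.
Qed.

(** The constituent y.`_r is comparable with y, hence with x; it cannot lie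
    above x, because p divides the order of x but not that of y.`_r. *)
Lemma twin_constt (p r : nat) x y : x \in G -> y \in G -> twin x y -> x \in <[y]> ->
  prime p -> p %| #[x] -> r != p -> y.`_r \in <[x]>.
Proof.
move=> Gx Gy /twinP xy xin pp px nrp.
have Gyr : y.`_r \in G by rewrite groupX.
have := xy _ Gyr; rewrite {2}/pcomparable cycle_constt orbT => /orP[xyr|//].
case/negP: nrp; have: r.-nat p.
  apply: pnat_dvd (p_elt_constt r y); apply: dvdn_trans px _.
  by apply: order_dvdG.
by rewrite pnatE // inE eq_sym.
Qed.

(** If the order of y had two prime divisors, all the primary constituents of
    y would lie in <[x]>, hence so would y. When x is the identity that argument
    has no prime to start from; then y is comparable with everything, so <[y]>
    contains every element of prime power order and G would be cyclic. *)
Lemma twin_prime_elt x y : ~~ cyclic G -> x \in G -> y \in G -> twin x y ->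
  <[x]> \proper <[y]> -> exists2 p : nat, prime p & p.-elt y.
Proof.
move=> ncG Gx Gy txy pxy.
have y1 : 1 < #[y] := leq_ltn_trans (order_gt0 x) (proper_card pxy).
case/properP: pxy; rewrite cycle_subG => xin [t ty tx].
have [ely|nel0] := boolP ((pdiv #[y]).-elt y).
  by exists (pdiv #[y]); first exact: pdiv_prime.
have {nel0}nel (p : nat) : ~~ p.-elt y.
  by apply: contra nel0 => py; rewrite /p_elt (pdiv_pnat y1 py).
have [x1 | nx1] := eqVneq #[x] 1%N.
  case/negP: ncG; apply: cyclicS (cycle_cyclic y); apply/subsetP=> z Gz.
  apply: mem_of_constt => r rp; have Gzr : z.`_r \in G by rewrite groupX.
  have := twinP _ _ txy _ Gzr; rewrite /pcomparable.
  have -> : x = 1 by apply/eqP; rewrite -order_eq1 x1.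
  rewrite group1 => /esym/orP[yz|//]; case/negP: (nel r).
  by apply: mem_p_elt yz; apply: p_elt_constt.
have x2 : 1 < #[x] by rewrite ltn_neqAle eq_sym nx1 order_gt0.
have pp := pdiv_prime x2; have px := pdiv_dvd #[x]; set p := pdiv _ in pp px.
have [q [qp qy nqp]] := not_pnat_witness (order_gt0 y) (nel p).
have qx : q %| #[x].
  apply: dvdn_trans (dvdn_constt qp qy) _; apply: order_dvdG.
  exact: (twin_constt Gx Gy txy xin pp px).
case/negP: tx; apply: subsetP ty; rewrite cycle_subG.
apply: mem_of_constt => r rp; have [->|nrp] := eqVneq r p.
  by apply: (twin_constt Gx Gy txy xin qp qx); rewrite eq_sym.
exact: (twin_constt Gx Gy txy xin pp px).
Qed.

(** If N had an element w of prime order q different from p, then x * w would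
    be comparable with x, which is its p-constituent, but not with y. *)
Lemma twin_pgroup (p : nat) x y N : x \in G -> y \in G -> twin x y ->
  <[x]> \proper <[y]> -> p.-elt y -> N \in maxcyc G -> x \in N -> p.-group N.
Proof.
move=> Gx Gy /twinP txy /properP[]; rewrite cycle_subG => xin [t ty tx] py NG Nx.
apply: contraT => /(not_pnat_witness (cardG_gt0 N))[q [qp qN nqp]].
have [w Nw ow] := Cauchy qp qN; case/maxcycP: NG => sNG cN _.
have cxw : commute x w by apply: (centsP (cyclic_abelian cN)).
have px : p.-elt x by apply: mem_p_elt xin.
have pw : p^'.-elt w by rewrite /p_elt ow pnatE // !inE.
have vp : (x * w).`_p = x by rewrite consttM // (constt_p_elt px) (constt1P _) ?mulg1.
have Gv : x * w \in G by rewrite (subsetP sNG) ?groupM.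
have := txy _ Gv; rewrite {1}/pcomparable -{1}vp cycle_constt => /esym/orP[yv|vy].
  case/negP: tx; apply: subsetP ty; rewrite cycle_subG -(constt_p_elt py).
  by case/cycleP: yv => k ->; rewrite consttX vp mem_cycle.
have : w = 1.
  by apply: (mulgI x); rewrite mulg1 -[RHS]vp constt_p_elt //; apply: mem_p_elt vy.
by move=> w1; move: qp; rewrite -ow w1 order1.
Qed.

(** Whatever is comparable with x or with y lies in a maximal cyclic subgroup
    containing x, hence also y. That subgroup is a cyclic p-group, in which any two
    elements are comparable. *)
Lemma pgroup_twin (p : nat) x y : x \in G -> y \in G -> x \in <[y]> ->
  (forall N, N \in maxcyc G -> x \in N -> p.-group N /\ y \in N) -> twin x y.
Proof.
move=> Gx Gy xy xN; apply/twinP=> z Gz.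
have total N : N \in maxcyc G -> x \in N -> forall a b, a \in N -> b \in N -> pcomparable a b.
  move=> NG Nx a b Na Nb; have [pN _] := xN N NG Nx; case/maxcycP: NG => _ cN _.
  rewrite /pcomparable -!cycle_subG -[_ || _]/((<[a]>%G \subset <[b]>%G) || _).
  by apply: (cyclic_pgroup_total cN pN); rewrite cycle_subG.
apply/idP/idP=> /orP[].
- move=> xz; have [N NG Nz] := mem_maxcyc Gz.
  have Nx : x \in N by apply: subsetP xz; rewrite cycle_subG.
  by apply: (total N) => //; case: (xN N NG Nx).
- by move=> zx; rewrite /pcomparable (subsetP _ _ zx) ?orbT ?cycle_subG.
- by move=> yz; rewrite /pcomparable (subsetP _ _ xy) ?cycle_subG.
move=> zy; have [N NG Ny] := mem_maxcyc Gy.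
have sub := subsetP (_ : <[y]> \subset N); rewrite cycle_subG in sub.
by apply: (total N) => //; apply: sub.
Qed.

(** Twins generating distinct subgroups force every maximal cyclic subgroup
    above them to be a p-group. *)
Lemma separated_not_pgroup M A : ~~ cyclic G -> M \in maxcyc G ->
  (forall p : nat, prime p -> ~~ p.-group M) -> A \subset M -> strict_chain A -> separated A.
Proof.
move=> ncG MG npM sAM /strict_chainP chA.
have sMG : M \subset G by case/maxcycP: MG.
have ntw x y : x \in A -> y \in A -> twin x y -> ~~ (<[x]> \proper <[y]>).
  move=> /(subsetP sAM) Mx /(subsetP sAM) My txy; apply/negP=> pxy.
  have [Gx Gy] := (subsetP sMG x Mx, subsetP sMG y My).
  have [p pp py] := twin_prime_elt ncG Gx Gy txy pxy.
  by case/negP: (npM p pp); apply: (twin_pgroup Gx Gy txy pxy py MG Mx).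
move=> x y Ax Ay txy; apply/eqP/contraT=> nxy.
case: (chA x y Ax Ay nxy) => pr; [move: (ntw x y Ax Ay txy) | move: (ntw y x Ay Ax)];
  rewrite ?pr // twin_sym => /(_ txy)//.
Qed.

End Twins.

(** * Twin classes in a maximal cyclic subgroup of prime power order *)

Lemma card_subgroups_cyclic_pgroup (gT : finGroupType) (p : nat) (K : {group gT}) :
  prime p -> cyclic K -> p.-group K ->
  #|[set D : {group gT} | D \subset K]| = (logn p #|K|).+1.
Proof.
move=> pp cK pK; have cardK := card_pgroup pK; set k := logn p #|K| in cardK *.
pose f (D : {group gT}) : 'I_k.+1 := inord (logn p #|D|).
have cardD (D : {group gT}) : D \subset K -> #|D| = (p ^ f D)%N.
  move=> sDK; rewrite /f inordK; first exact: card_pgroup (pgroupS sDK pK).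
  by rewrite ltnS /k dvdn_leq_log ?cardG_gt0 ?cardSg.
have f_inj : {in [set D : {group gT} | D \subset K] &, injective f}.
  move=> D E; rewrite !inE => sDK sEK eqf; apply/eqP.
  by rewrite -val_eqE /= (eq_subG_cyclic cK) // !cardD // eqf.
rewrite -(card_in_imset f_inj) -[RHS]card_ord -cardsT; congr #|pred_of_set _|.
apply/setP=> i; rewrite inE; have /cyclicP[a defK] := cK.
have di : (p ^ i)%N %| #[a] by rewrite orderE -defK cardK dvdn_exp2l // -ltnS.
(* Every exponent i is attained, by the subgroup of order p ^ i. *)
have : <[a ^+ (#[a] %/ p ^ i)]>%G \in [set L : {group gT} | L \subset <[a]> & #|L| == (p ^ i)%N].
  by rewrite cycle_sub_group // set11.
rewrite inE -defK => /andP[sLK /eqP cardL]; apply/imsetP.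
exists <[a ^+ (#[a] %/ p ^ i)]>%G; rewrite ?inE //; apply: val_inj.
by rewrite /f cardL pfactorK //= inordK.
Qed.

(** On a sorted list an upward closed property holds exactly from the first
    position where it holds onwards. *)
Lemma count_find_sorted (T : Type) (leT : rel T) (a : pred T) (s : seq T) :
  transitive leT -> sorted leT s -> (forall x y, leT x y -> a x -> a y) ->
  (count a s + find a s = size s)%N.
Proof.
move=> leT_tr + a_up; elim: s => //= x s IHs path_s; case: ifP => ax.
  rewrite addn0 add1n; congr _.+1; apply/eqP; rewrite -all_count.
  by apply: sub_all (order_path_min leT_tr path_s) => y /a_up; apply.
by rewrite addnS IHs ?(path_sorted path_s).
Qed.

Section PrimaryMaximalCyclic.
Variables (gT : finGroupType) (G M : {group gT}) (p : nat).
Hypotheses (pp : prime p) (MG : M \in maxcyc G) (pM : p.-group M).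
Implicit Types (x y : gT) (A : {set gT}) (C D N : {group gT}).

Local Notation twin := (closed_twins G (@power_adj gT)).

(** Among the subgroups of M these are the ones of order at most p ^ lambda, see
    [lambda_other]. *)
Definition in_other D := [exists N in maxcyc G :\: maxcyc_p G p, D \subset N].

Definition meets : {set {group gT}} := [set (M :&: N)%G | N in maxcyc_p G p].

(** One subgroup of M for each twin class that meets M: a subgroup inside some
    maximal cyclic subgroup that is not a p-group is twin to no other, and the
    remaining ones are twin to the smallest meet M :&: N above them, which
    represents their class. *)
Definition layers : {set {group gT}} :=
  [set D : {group gT} | (D \subset M) && in_other D] :|: [set C in meets | ~~ in_other C].

Let cM : cyclic M. Proof. by case/maxcycP: MG. Qed.
Let sMG : M \subset G. Proof. by case/maxcycP: MG. Qed.
Let MGp : M \in maxcyc_p G p. Proof. by rewrite inE MG. Qed.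

Lemma in_otherS C D : C \subset D -> in_other D -> in_other C.
Proof.
move=> sCD /exists_inP[N NG sDN]; apply/exists_inP; exists N => //.
exact: subset_trans sDN.
Qed.

Lemma in_otherP D :
  reflect (exists N, [/\ N \in maxcyc G, ~~ p.-group N & D \subset N]) (in_other D).
Proof.
apply: (iffP exists_inP) => [[N] | [N [NG npN sDN]]].
  rewrite in_setD => /andP[nNp NG] sDN; exists N; split=> //.
  by apply: contra nNp => pN; rewrite inE NG.
exists N; rewrite // in_setD NG andbT; apply: contra npN.
by rewrite inE => /andP[].
Qed.

Definition nearest_meet x : {group gT} :=
  (M :&: [arg min_(N < M | (N \in maxcyc_p G p) && (x \in N)) #|M :&: N|])%G.

(** Least order among the meets containing x means least for inclusion, because
    the subgroups of M form a chain. *)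
Lemma nearest_meetP x : x \in M ->
  [/\ nearest_meet x \in meets, x \in nearest_meet x
    & forall N, N \in maxcyc_p G p -> x \in N -> nearest_meet x \subset N].
Proof.
move=> Mx; rewrite /nearest_meet; case: arg_minnP => [|N /andP[NG Nx] minN].
  by rewrite MGp.
split; [by apply/imsetP; exists N | by rewrite /= inE Mx|move=> N' NG' Nx'].
apply: subset_trans (subsetIr M N').
rewrite (cyclic_pgroup_subG_card cM pM) ?subsetIl //.
by apply: minN; rewrite NG'.
Qed.

Definition layer x := if in_other <[x]> then <[x]>%G else nearest_meet x.

Lemma layer_layers x : x \in M -> layer x \in layers.
Proof.
move=> Mx; rewrite /layer; case: ifP => [o | /negbT no]; rewrite !inE.
  by rewrite o cycle_subG Mx.
have [mx xx _] := nearest_meetP Mx; rewrite mx (contra (in_otherS _) no) ?orbT //.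
by rewrite cycle_subG.
Qed.

(** Above p ^ lambda, every maximal cyclic subgroup containing x is a p-group
    containing the meet attached to x, hence y, so [pgroup_twin] applies. *)
Lemma layer_twin x y : x \in M -> y \in M -> <[x]> \proper <[y]> -> layer x = layer y -> twin x y.
Proof.
move=> Mx My /properP[sxy [t ty tx]]; have [Gx Gy] := (subsetP sMG x Mx, subsetP sMG y My).
rewrite cycle_subG in sxy; rewrite /layer.
case: ifP => ox; case: ifP => oy eq_layer.
- by move: ty tx; rewrite -[<[y]>]/(gval _) -eq_layer => ->.
- have [_ yy _] := nearest_meetP My; rewrite -eq_layer /= -cycle_subG in yy.
  by move: tx; rewrite (subsetP yy _ ty).
- by rewrite (in_otherS _ oy) ?cycle_subG in ox.
apply: (pgroup_twin (p := p)) => // N NG Nx.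
have pN : p.-group N.
  apply: contraFT ox => npN; apply/in_otherP; exists N; split=> //.
  by rewrite cycle_subG.
split=> //; have [_ yy _] := nearest_meetP My; have [_ _ sub] := nearest_meetP Mx.
by rewrite -eq_layer in yy; apply: subsetP yy; apply: sub; rewrite // inE NG.
Qed.

(** Distinct elements of the chain with the same layer would be twins. *)
Lemma leq_layers A : A \subset M -> strict_chain A -> separated G A -> #|A| <= #|layers|.
Proof.
move=> sAM /strict_chainP chA sepA.
have l_inj : {in A &, injective layer}.
  move=> x y Ax Ay eql; have [Mx My] := (subsetP sAM x Ax, subsetP sAM y Ay).
  have [//|nxy] := eqVneq x y.
  case: (chA x y Ax Ay nxy) => pr; first exact: sepA (layer_twin _ _ _ _).
  by apply/esym/sepA => //; apply: layer_twin.
rewrite -(card_in_imset l_inj); apply: subset_leq_card.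
by apply/subsetP=> _ /imsetP[x /(subsetP sAM) Mx ->]; apply: layer_layers.
Qed.

(** A layer inside a maximal cyclic subgroup that is not a p-group is kept apart
    from larger subgroups of M by [twin_pgroup]; a layer M :&: N is kept apart from
    them by [twin_maxcyc], as N contains x but no larger subgroup of M. *)
Lemma layers_not_twin D x y : x \in G -> y \in M -> D \in layers -> D :=: <[x]> ->
  <[x]> \proper <[y]> -> ~~ twin x y.
Proof.
move=> Gx My; rewrite !inE => D_layers defD pxy; apply/negP=> txy.
have Gy := subsetP sMG y My; have py : p.-elt y by apply: mem_p_elt pM My.
have Dx : x \in D by rewrite defD cycle_id.
case/orP: D_layers => [/andP[_ /in_otherP[N [NG npN sDN]]] | /andP[/imsetP[N]]].
  by case/negP: npN; apply: (twin_pgroup Gx Gy txy pxy py NG (subsetP sDN x Dx)).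
rewrite inE => /andP[NG pN] defDN _; have Nx : x \in N.
  by move: Dx; rewrite defDN => /setIP[].
have : y \in D by rewrite defDN inE My (twin_maxcyc Gx Gy txy NG Nx).
by rewrite defD -cycle_subG => /(proper_sub_trans pxy); rewrite properxx.
Qed.

(** Generators of the layers reach the bound of [leq_layers]: they are comparable
    because M is a cyclic p-group. *)
Lemma layers_chain : exists A,
  [/\ A \subset M, strict_chain A, separated G A & #|A| = #|layers|].
Proof.
have sLM D : D \in layers -> D \subset M.
  rewrite !inE => /orP[/andP[] // | /andP[/imsetP[N _ ->] _]].
  exact: subsetIl.
pose g D := odflt 1 [pick x | D :==: <[x]>].
have gP D : D \in layers -> D :=: <[g D]>.
  move/sLM/cyclicS/(_ cM)/cyclicP=> [x defD]; rewrite /g.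
  by case: pickP => [y /eqP | /(_ x)] //; rewrite defD eqxx.
have g_inj : {in layers &, injective g}.
  by move=> D E LD LE eqg; apply: val_inj; rewrite /= (gP D) ?(gP E) ?eqg.
have gM D : D \in layers -> g D \in M.
  by move=> LD; rewrite -cycle_subG -gP ?sLM.
have sAM : g @: layers \subset M by apply/subsetP=> _ /imsetP[D LD ->]; apply: gM.
have chA : strict_chain (g @: layers).
  apply/strict_chainP=> _ _ /imsetP[D LD ->] /imsetP[E LE ->] nDE.
  have neq : D :!=: E by apply: contraNneq nDE => /val_inj->.
  rewrite -!gP // !properEneq neq eq_sym neq /=.
  by apply/orP; apply: (cyclic_pgroup_total cM pM); apply: sLM.
exists (g @: layers); split; rewrite ?card_in_imset // => _ _ /imsetP[D LD ->] /imsetP[E LE ->] txy.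
have GgD F : F \in layers -> g F \in G by move=> /gM; apply: (subsetP sMG).
apply/eqP/contraT=> nDE.
case: (strict_chainP _ chA _ _ (imset_f g LD) (imset_f g LE) nDE) => pr.
  by have := layers_not_twin (GgD D LD) (gM E LE) LD (gP D LD) pr; rewrite txy.
by have := layers_not_twin (GgD E LE) (gM D LD) LE (gP E LE) pr; rewrite twin_sym txy.
Qed.

Lemma count_meet_chain (a : pred {group gT}) :
  count a (meet_chain G p M) = #|[set C in meets | a C]|.
Proof.
rewrite /meet_chain (seq.permP (permEl (perm_sort _ _))) -/meets cardE.
rewrite -size_filter; apply/perm_size/uniq_perm => [||C].
- exact/filter_uniq/enum_uniq.
- exact: enum_uniq.
by rewrite mem_filter !mem_enum inE andbC.
Qed.

Lemma sorted_meet_chain :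
  sorted (fun C D => C \subset D) (meet_chain G p M).
Proof.
apply: (sort_sorted_in (P := mem meets)) => [C D /imsetP[N _ ->] /imsetP[N' _ ->]|].
  by apply: (cyclic_pgroup_total cM pM); apply: subsetIl.
by apply/allP=> C; rewrite mem_enum.
Qed.

(** The subgroups of M inside a maximal cyclic subgroup that is not a p-group are
    those below the largest meet of M with such a subgroup, of order p ^ lambda;
    there are lambda + 1 of them, which is also right when there are none and lambda is -1. *)
Lemma lambda_other :
  ((#|[set D : {group gT} | (D \subset M) && in_other D]|)%:Z = lambda G p M + 1)%R /\
  (forall C, C \subset M -> (p%:R ^ lambda G p M < #|C|%:R :> rat)%R = ~~ in_other C).
Proof.
rewrite /lambda; case: ifPn => [/eqP all_p | not_all].
  have other_F C : in_other C = false.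
    by apply/exists_inP=> -[N]; rewrite all_p setDv inE.
  split; first by rewrite (eq_card0 (A := pred_of_set _)) // => D; rewrite inE other_F andbF.
  move=> C _; rewrite other_F /=.
  apply: lt_le_trans (_ : 1 <= _)%R; last by rewrite ler1n cardG_gt0.
  by rewrite exprN1 invf_lt1 ?ltr0n ?ltr1n ?prime_gt1 ?prime_gt0.
have [|N0 N0G maxN0] := @eq_bigmax_cond _ (mem (maxcyc G :\: maxcyc_p G p)) (fun N => #|M :&: N|).
  rewrite lt0n; apply: contraNneq not_all => /eqP; rewrite cards_eq0 setD_eq0 => sub.
  by rewrite eqEsubset sub andbT; apply/subsetP=> N; rewrite inE => /andP[].
have other_max C : C \subset M -> in_other C = (C \subset M :&: N0).
  move=> sCM; apply/idP/idP=> [/exists_inP[N NG sCN] | sC]; last first.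
    apply/exists_inP; exists N0 => //; apply: subset_trans sC _; exact: subsetIr.
  have sCMN : C \subset M :&: N by rewrite subsetI sCM.
  apply: subset_trans sCMN _.
  rewrite (cyclic_pgroup_subG_card cM pM) ?subsetIl //= -maxN0.
  exact: (@leq_bigmax_cond _ (mem _) (fun N => #|M :&: N|)).
rewrite maxN0; split=> [|C sCM]; last first.
  rewrite -exprnP -natrX -(card_pgroup (pgroupS (subsetIl M N0) pM)) ltr_nat.
  by rewrite other_max // (cyclic_pgroup_subG_card cM pM) ?subsetIl // ltnNge.
rewrite -PoszD addn1 -card_subgroups_cyclic_pgroup //=.
- congr (Posz #|pred_of_set _|); apply/setP=> D; rewrite !inE.
  by case sDM: (D \subset M); rewrite /= ?other_max // subsetI sDM.
- exact: cyclicS (subsetIl _ _) cM.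
- exact: pgroupS (subsetIl _ _) pM.
Qed.

(** The layers below p ^ lambda contribute lambda + 1, and those above are the
    meets from position first_above on, that is s - s' + 1 of them. *)
Lemma card_layers :
  ((#|layers|)%:Z = (size (meet_chain G p M))%:Z - (first_above G p M)%:Z + lambda G p M + 2)%R.
Proof.
have [card_other above] := lambda_other.
rewrite /layers cardsU disjoint_setI0 ?cards0 ?subn0; last first.
  by apply/pred0P=> D; rewrite !inE /=; case: (in_other D); rewrite ?andbF.
rewrite PoszD card_other /first_above -count_meet_chain.
have eq_above : {in meet_chain G p M, (fun C => ~~ in_other C) =1
    (fun C : {group gT} => (p%:R ^ lambda G p M < #|C|%:R :> rat)%R)}.
  move=> C; rewrite /meet_chain mem_sort mem_enum => /imsetP[N _ ->].
  by rewrite above ?subsetIl.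
rewrite -(eq_in_find eq_above).
rewrite -(@count_find_sorted _ _ (fun C => ~~ in_other C) _ _ sorted_meet_chain); first last.
- by move=> C D sCD; apply: contra; apply: in_otherS.
- by move=> C D E; apply: subset_trans.
rewrite PoszD -addn1 PoszD; ring.
Qed.

End PrimaryMaximalCyclic.

(** * The clique number of the reduced graph *)

Lemma mem_bigcup_seq (T : finType) (I : Type) (r : seq I) (F : I -> {set T}) (x : T) :
  (x \in \bigcup_(i <- r) F i) = has (fun i => x \in F i) r.
Proof. by elim: r => [|i r IHr]; rewrite ?big_nil ?big_cons inE //= IHr. Qed.

Section ReducedCliqueNumber.
Variables (gT : finGroupType) (G : {group gT}) (U : {set gT}).
Hypothesis ncG : ~~ cyclic G.
Hypothesis hU : is_reduced_vertex_set G (@power_adj gT) U.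
Implicit Types M : {group gT}.

Local Notation omega := (clique_number U (@power_adj gT)).

(** The trivial subgroup is maximal cyclic only in the trivial group. *)
Lemma maxcyc_order_gt1 M : M \in maxcyc G -> 1 < #|M|.
Proof.
case/maxcycP=> sMG _ maxM; rewrite ltnNge; apply: contra ncG => M1.
have {M1}M1 : M :=: 1 by apply/eqP; rewrite trivg_card_le1.
suff -> : G :=: 1 by apply: cyclic1.
apply/trivgP/subsetP=> x Gx; rewrite -M1 -(maxM <[x]>%G) ?cycle_id ?cycle_subG ?cycle_cyclic //.
by rewrite M1 sub1G.
Qed.

Lemma maxcyc_p_primes M (p : nat) : prime p -> M \in maxcyc_p G p -> p \in primes #|G|.
Proof.
move=> pp; rewrite inE => /andP[MG pM]; have M1 := maxcyc_order_gt1 MG.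
rewrite mem_primes pp cardG_gt0 /=; apply: dvdn_trans (cardSg (_ : M \subset G)).
  by rewrite -(pdiv_pnat M1 pM) pdiv_dvd.
by case/maxcycP: MG.
Qed.

(** The primes dividing the order of G suffice to detect the p-groups among
    its maximal cyclic subgroups. *)
Lemma mixedP M : M \in maxcyc G ->
  reflect (forall p : nat, prime p -> ~~ p.-group M)
    (M \in maxcyc G :\: \bigcup_(p <- primes #|G|) maxcyc_p G p).
Proof.
move=> MG; rewrite in_setD MG andbT mem_bigcup_seq.
apply: (iffP hasPn) => [npM p pp | npM p].
  apply/negP=> pM; have Mp : M \in maxcyc_p G p by rewrite inE MG.
  by move: (npM p (maxcyc_p_primes pp Mp)); rewrite Mp.
by rewrite mem_primes inE MG => /andP[/npM].
Qed.

Lemma alpha_le_omega (p : nat) : prime p -> (alpha G p <= omega%:Z)%R.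
Proof.
move=> pp; apply: bigmax_le => // M; rewrite inE => /andP[MG pM].
rewrite -(card_layers pp MG pM) lez_nat.
have [A [sAM chA sepA <-]] := layers_chain MG pM.
apply: (leq_clique_number hU) => //; apply: subset_trans sAM _.
by case/maxcycP: MG.
Qed.

Lemma sigma_le_omega M : M \in maxcyc G -> (forall p : nat, prime p -> ~~ p.-group M) ->
  (sigma #|M|).+1 <= omega.
Proof.
move=> MG npM; rewrite sigma_not_prime_power ?maxcyc_order_gt1 //.
have [sMG cM _] := maxcycP _ _ MG.
have [A sAM [chA <-]] := cyclic_strict_chain cM.
apply: (leq_clique_number hU) => //; first exact: subset_trans sMG.
exact: separated_not_pgroup ncG MG npM sAM chA.
Qed.

(** A largest clique lies in a single maximal cyclic subgroup M, whose type
    decides which of the two bounds applies to it. *)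
Lemma omega_attained : exists2 M, M \in maxcyc G &
  (forall p : nat, prime p -> p.-group M -> p \in primes #|G| /\ (omega%:Z <= alpha G p)%R) /\
  ((forall p : nat, prime p -> ~~ p.-group M) -> omega <= (sigma #|M|).+1).
Proof.
have [A [sAG chA sepA cardA]] := clique_number_witness hU.
have [M MG sAM] := strict_chain_maxcyc sAG chA; exists M => //.
split=> [p pp pM | npM].
  have Mp : M \in maxcyc_p G p by rewrite inE MG.
  split; first exact: maxcyc_p_primes Mp.
  apply: le_trans (le_bigmax_cond _ _ Mp).
  by rewrite -(card_layers pp MG pM) lez_nat -cardA leq_layers.
rewrite sigma_not_prime_power ?maxcyc_order_gt1 // -cardA.
exact: strict_chain_Omega.
Qed.

End ReducedCliqueNumber.

Theorem theorem3p2 (gT : finGroupType) (G : {group gT}) (n : nat)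
    (hn : #|G| = n) (hG : ~~ cyclic G)
    (U : {set gT}) (hU : is_reduced_vertex_set G (@power_adj gT) U) :
  (CP_group G ->
     ((clique_number U (@power_adj gT))%:Z =
        \big[Order.max/0]_(p <- primes n) alpha G p)%R) /\
  (~ CP_group G ->
     ((clique_number U (@power_adj gT))%:Z =
        Order.max
          (\big[Order.max/0]_(p <- primes n) alpha G p)
          (\big[Order.max/0]_(M in maxcyc G :\: \bigcup_(p <- primes n) maxcyc_p G p)
             ((sigma #|M|)%:Z + 1)))%R).
Proof.
rewrite -{n}hn.
have alpha_le : (\big[Order.max/0]_(p <- primes #|G|) alpha G p <=
    (clique_number U (@power_adj gT))%:Z)%R.
  rewrite big_seq; apply: bigmax_le => // p; rewrite mem_primes => /and3P[pp _ _].
  exact: alpha_le_omega.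
have [M MG [primary mixed]] := omega_attained hG hU.
have sigma_le : (\big[Order.max/0]_(N in maxcyc G :\: \bigcup_(p <- primes #|G|) maxcyc_p G p)
    ((sigma #|N|)%:Z + 1) <= (clique_number U (@power_adj gT))%:Z)%R.
  apply: bigmax_le => // N N_mixed.
  have NG : N \in maxcyc G by case/setDP: N_mixed.
  rewrite -PoszD addn1 lez_nat; apply: (sigma_le_omega hG hU NG).
  exact: (mixedP hG NG N_mixed).
have le_alphas p : p \in primes #|G| ->
    (alpha G p <= \big[Order.max/0]_(q <- primes #|G|) alpha G q)%R.
  by move=> pG; apply: le_bigmax_seq.
split=> [cpG | _].
  apply: le_anti; rewrite alpha_le andbT.
  have [x Gx defM] := mem_maxcyc_gen MG.
  have [p [k [pp ox]]] := cpG x Gx.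
  have pM : (p.-group M)%g by rewrite /pgroup defM -[#|_|]/(#[x]%g) ox pnatX pnat_id.
  have [pG le] := primary p pp pM.
  by apply: le_trans le _; apply: le_alphas.
apply: le_anti; rewrite ge_max alpha_le sigma_le !andbT.
rewrite le_max.
have [M_mixed|nmix] := boolP (M \in maxcyc G :\: \bigcup_(p <- primes #|G|) maxcyc_p G p).
  have le := mixed (mixedP hG MG M_mixed).
  apply/orP; right; apply: (Order.TotalTheory.bigmax_sup M); [exact: M_mixed|].
  by rewrite -PoszD addn1 lez_nat.
move: nmix; rewrite in_setD MG andbT negbK mem_bigcup_seq => /hasP[p pG].
rewrite inE => /andP[_ pM].
have pp : prime p by move: pG; rewrite mem_primes => /and3P[].
have [_ le] := primary p pp pM.
by apply/orP; left; apply: le_trans le _; apply: le_alphas.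
Qed.
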